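(* Let $X_1,\dots,X_n$ be operators in a complex Hilbert space $\mathcal{H}$, each Hermitian or skew-Hermitian, defined on a common invariant domain $D$. Let $m$ be a sequence of positive numbers satisfying (A0), (A1), (A2) and (A3'): there is $L\ge1$ with $p\,m_{p-1}\le L\,m_p$ for all $p\ge1$; set $m^{(1)}=\dots=m^{(n)}=m$ and $\mathbf{m}=(m,\dots,m)$, $\mathbf{X}=(X_1,\dots,X_n)$. If $[X_i,X_j]\in\mathrm{span}\{X_1,\dots,X_n\}$ (on $D$) for every $i,j\in\{1,\dots,n\}$, then $u\in D$ belongs to $\mathcal{S}_{\mathbf{m}}(\mathbf{X})$ if and only if $u\in\bigcap_{j=1}^n\mathcal{S}_m(X_j)$.
   Context: A common invariant domain $D$ means $D\subset\mathrm{Dom}(X_j)$ and $X_jD\subset D$ for all $j$. Notation: $M(n)=\bigcup_{k\ge1}\{1,\dots,n\}^k$; for $\alpha=(i_1,\dots,i_k)$, $|\alpha|=k$, $|\alpha|_j=\mathrm{card}\{l:i_l=j\}$; $\mathbf{X}_\alpha=X_{i_1}\cdots X_{i_k}$; $C^\infty(\mathbf{X})=\{u: u\in\mathrm{Dom}(\mathbf{X}_\alpha)\ \forall\alpha\in M(n)\}$; $\mathbf{m}_\alpha=m^{(1)}_{|\alpha|_1}\cdots m^{(n)}_{|\alpha|_n}$; $\mathcal{S}_{\mathbf{m}}(\mathbf{X})=\{u\in C^\infty(\mathbf{X}):\exists A,C>0,\ \|\mathbf{X}_\alpha u\|\le CA^{|\alpha|}\mathbf{m}_\alpha\ \forall\alpha\in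 M(n)\}$; for a single operator, $\mathcal{S}_m(X_j)=\{u\in C^\infty(X_j):\exists A,C>0,\ \|X_j^ku\|\le CA^km_k\ \forall k\ge1\}$. Conditions: (A0) $m_0=m_1=1$; (A1) $m_p^2\le m_{p-1}m_{p+1}$ for $p\ge1$; (A2) there is $H>0$ with $m_{p+q}\le H^{p+q}m_pm_q$ for all $p,q\in\mathbb{N}$. *)

(* Defs.v *)
From HB Require Import structures.
From mathcomp Require Import all_boot all_order all_algebra.
From mathcomp Require Import complex.
From mathcomp Require Import reals.
Set Implicit Arguments. Unset Strict Implicit. Unset Printing Implicit Defensive.
Import Order.TTheory GRing.Theory Num.Theory.
Local Open Scope ring_scope.

Section Hilbert.
Variable R : realType.
Local Notation C := R[i].
Variable V : lmodType C.

Definition is_inner_product (ip : V -> V -> C) : Prop :=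
  [/\ (forall (a : C) (u v w : V), ip (a *: u + v) w = a * ip u w + ip v w),
      (forall u v : V, ip v u = conjc (ip u v)),
      (forall u : V, 0 <= ip u u) &
      (forall u : V, ip u u = 0 -> u = 0)].

Definition hnorm (ip : V -> V -> C) (v : V) : R := Num.sqrt (complex.Re (ip v v)).

Definition is_complete (ip : V -> V -> C) : Prop :=
  forall s : nat -> V,
    (forall e : R, 0 < e -> exists N, forall p q, (N <= p)%N -> (N <= q)%N ->
        hnorm ip (s p - s q) < e) ->
    exists l : V, forall e : R, 0 < e -> exists N, forall p, (N <= p)%N ->
        hnorm ip (s p - l) < e.

Definition is_hilbert (ip : V -> V -> C) : Prop := is_inner_product ip /\ is_complete ip.

(* a (possibly unbounded) linear operator with domain dom (a subspace), action X on dom *)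
Definition is_operator (dom : V -> Prop) (X : V -> V) : Prop :=
  dom 0 /\ forall (a : C) (u v : V), dom u -> dom v ->
    dom (a *: u + v) /\ X (a *: u + v) = a *: X u + X v.

Definition is_hermitian (ip : V -> V -> C) (dom : V -> Prop) (X : V -> V) : Prop :=
  forall u v, dom u -> dom v -> ip (X u) v = ip u (X v).

Definition is_skew_hermitian (ip : V -> V -> C) (dom : V -> Prop) (X : V -> V) : Prop :=
  forall u v, dom u -> dom v -> ip (X u) v = - ip u (X v).

Fixpoint pow_dom (dom : V -> Prop) (X : V -> V) (k : nat) (u : V) : Prop :=
  match k with
  | 0 => True
  | k'.+1 => pow_dom dom X k' u /\ dom (iter k' X u)
  end.

Definition Cinf1 (dom : V -> Prop) (X : V -> V) (u : V) : Prop :=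
  forall k, pow_dom dom X k u.

Definition S_single (ip : V -> V -> C) (dom : V -> Prop) (X : V -> V)
    (m : nat -> R) (u : V) : Prop :=
  Cinf1 dom X u /\ exists A Cc : R, 0 < A /\ 0 < Cc /\
    forall k, (1 <= k)%N -> hnorm ip (iter k X u) <= Cc * A ^+ k * m k.

Variable n : nat.

Fixpoint wapply (X : 'I_n -> V -> V) (w : seq 'I_n) (u : V) : V :=
  match w with
  | [::] => u
  | i :: w' => X i (wapply X w' u)
  end.

Fixpoint wdom (dom : 'I_n -> V -> Prop) (X : 'I_n -> V -> V) (w : seq 'I_n) (u : V) : Prop :=
  match w with
  | [::] => True
  | i :: w' => wdom dom X w' u /\ dom i (wapply X w' u)
  end.

Definition Cinf (dom : 'I_n -> V -> Prop) (X : 'I_n -> V -> V) (u : V) : Prop :=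
  forall w : seq 'I_n, (0 < size w)%N -> wdom dom X w u.

Definition mword (m : nat -> R) (w : seq 'I_n) : R :=
  \prod_(j < n) m (count_mem j w).

Definition S_multi (ip : V -> V -> C) (dom : 'I_n -> V -> Prop) (X : 'I_n -> V -> V)
    (m : nat -> R) (u : V) : Prop :=
  Cinf dom X u /\ exists A Cc : R, 0 < A /\ 0 < Cc /\
    forall w : seq 'I_n, (0 < size w)%N ->
      hnorm ip (wapply X w u) <= Cc * A ^+ size w * mword m w.

Definition common_invariant_domain (dom : 'I_n -> V -> Prop) (X : 'I_n -> V -> V)
    (D : V -> Prop) : Prop :=
  forall j u, D u -> dom j u /\ D (X j u).

Definition commutators_in_span (X : 'I_n -> V -> V) (D : V -> Prop) : Prop :=
  forall i j : 'I_n, exists c : 'I_n -> C, forall u, D u ->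
    X i (X j u) - X j (X i u) = \sum_(k < n) c k *: X k u.

End Hilbert.

Definition cond_A0 (R : realType) (m : nat -> R) : Prop := m 0%N = 1 /\ m 1%N = 1.
Definition cond_A1 (R : realType) (m : nat -> R) : Prop :=
  forall p, (1 <= p)%N -> m p ^+ 2 <= m p.-1 * m p.+1.
Definition cond_A2 (R : realType) (m : nat -> R) : Prop :=
  exists H : R, 0 < H /\ forall p q, m (p + q)%N <= H ^+ (p + q) * m p * m q.
Definition cond_A3' (R : realType) (m : nat -> R) : Prop :=
  exists L : R, 1 <= L /\ forall p, (1 <= p)%N -> p%:R * m p.-1 <= L * m p.

(* Main.v *)
Require Import Defs.
From HB Require Import structures.
From mathcomp Require Import all_boot all_order all_algebra.
From mathcomp Require Import complex.
From mathcomp Require Import reals.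
From mathcomp.analysis Require Import sequences exp.
From mathcomp Require Import ring lra zify.
Set Implicit Arguments. Unset Strict Implicit. Unset Printing Implicit Defensive.
Import Order.TTheory GRing.Theory Num.Theory.
Local Open Scope ring_scope.

(* Put [F z = |<X_z u, u>|] for a word [z]. Moving operators across the inner product, F satisfies
   the Cauchy-Schwarz inequality [F (p q) ^ 2 <= F (p p^rev) * F (q^rev q)], and
   [F (w^rev w) = ||X_w u|| ^ 2]; exchanging two adjacent letters changes F by at most [K] times a
   sum of values of F at words that are shorter by one. The hypothesis on the single operators
   bounds [F (i^(2k))].

   Let [N k] be the maximum of [F z * exp (- Psi_i z)] over letters [i] and words [z] of length [k],
   where [Psi_i] is a large multiple of the entropy-like concave function [t * (1 + ln (k / t))] of
   the number [t] of letters other than [i], plus [1 / k] times a signed count of the inversions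
   between [i] and the other letters. At a maximizing pair, either some letter before an [i] can be
   exchanged with it, which lowers [Psi_i] by [2 / k] and yields [N k <= const * k * N (k - 1)]; or
   [z] starts with all its [i]'s, and then cutting [z] in the middle and applying Cauchy-Schwarz
   contradicts maximality by concavity, unless [z] is a power of [i]. Hence
   [N (2k + 2) <= max (F (i^(2k+2)), (const * k) ^ 2 * N (2k))], and condition (A3') absorbs the
   factors [k]. Since [Psi_i <= const * k], the weights cost only a geometric factor. *)

(** * Logarithm inequalities and the concave function [s * (1 + ln (a / s))] *)

Section Entropy.
Variable R : realType.
Implicit Types a b s t x y : R.

Lemma ln_le_subr1 x : 0 < x -> ln x <= x - 1.
Proof.
move=> x0; have -> : x = 1 + (x - 1) by ring.
by rewrite [leRHS]addrAC subrr add0r; apply: le_ln1Dx; lra.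
Qed.

Lemma ln_ge_1subV x : 0 < x -> 1 - x^-1 <= ln x.
Proof.
move=> x0; have := @ln_le_subr1 x^-1; rewrite invr_gt0 => /(_ x0).
by rewrite lnV ?posrE//; lra.
Qed.

Lemma ln_sqrt x : 0 < x -> ln x = 2 * ln (Num.sqrt x).
Proof.
move=> x0; rewrite -[in LHS](sqr_sqrtr (ltW x0)) lnXn ?sqrtr_gt0//.
by rewrite mulr_natl.
Qed.

(** Homogeneous of degree one, with derivative [ln (a / s)] in [s]. At [s = 0] the quotient is 0 by
    convention, and the factor [s] gives the continuous extension 0. *)
Definition ent a s : R := s * (1 + ln (a / s)).

Lemma ent0 a : ent a 0 = 0.
Proof. by rewrite /ent mul0r. Qed.

Lemma le_entl a b s : 0 <= s -> s <= a -> a <= b -> ent a s <= ent b s.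
Proof.
rewrite le_eqVlt => /predU1P[<-|s0] sa ab; first by rewrite !ent0.
rewrite /ent ler_pM2l// lerD2l ler_ln ?posrE ?divr_gt0//; [|lra..].
by rewrite ler_pM2r// invr_gt0.
Qed.

(** Split [ln (a / s)] as [ln (a / t) + ln (t / s)]: here [s * ln (t / s) <= t - s], and
    [ln (a / t)] is nonnegative. *)
Lemma le_entr a s t : 0 <= s -> s <= t -> t <= a -> ent a s <= ent a t.
Proof.
rewrite le_eqVlt => /predU1P[<-|s0] st ta.
  rewrite ent0 /ent mulr_ge0//.
  move: st; rewrite le_eqVlt => /predU1P[<-|t0]; first by rewrite invr0 mulr0 ln0//; lra.
  by rewrite addr_ge0// ln_ge0// ler_pdivlMr// mul1r.
have t0 : 0 < t by lra.
have a0 : 0 < a by lra.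
have -> : ent a s = s * (1 + ln (a / t)) + s * ln (t / s).
  rewrite /ent -mulrDr -addrA -lnM ?posrE ?divr_gt0//.
  by rewrite mulrA divfK ?gt_eqF.
have h1 : s * ln (t / s) <= t - s.
  have := @ln_le_subr1 (t / s); rewrite divr_gt0// => /(_ isT) h.
  apply: (le_trans (ler_wpM2l (ltW s0) h)).
  by rewrite mulrBr mulr1 mulrCA divff ?gt_eqF// mulr1.
have h2 : 0 <= ln (a / t) by rewrite ln_ge0// ler_pdivlMr// mul1r.
have h3 : 0 <= (t - s) * ln (a / t) by rewrite mulr_ge0//; lra.
by rewrite /ent; nra.
Qed.

Lemma ent_diag a : ent a a = a.
Proof.
have [->|a0] := eqVneq a 0; first by rewrite ent0.
by rewrite /ent divff// ln1 addr0 mulr1.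
Qed.

Lemma ent_le a s : 0 <= s -> s <= a -> ent a s <= a.
Proof. by move=> s0 sa; rewrite -{2}(ent_diag a); exact: le_entr. Qed.

(* Gain of the symmetrization when one half is a pure power. *)
Lemma ent_gain_pure L l t : 0 < t -> t <= l -> 3 * l <= 2 * L ->
  ent (2 * l) (2 * t) + 2 * t / 3 <= 2 * ent L t.
Proof.
move=> t0 tl lL; have l0 : 0 < l by lra.
have L0 : 0 < L by lra.
rewrite /ent -mulf_div divff ?mul1r; last lra.
have -> : L / t = (L / l) * (l / t) by rewrite mulrA divfK ?gt_eqF.
rewrite (@lnM _ (L / l)) ?posrE ?divr_gt0//.
have h : 3^-1 <= ln (L / l).
  apply: le_trans (ln_ge_1subV _); last by rewrite divr_gt0.
  rewrite invf_div; have : l / L <= 2 / 3 by rewrite ler_pdivrMr//; lra.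
  by lra.
have := ler_wpM2l (ltW t0) h; lra.
Qed.

(** The linear bound [ln r <= r - 1], taken at [r = sqrt (1 - x)] and doubled, retains a quadratic
    term that the same bound at [1 - x] loses. *)
Lemma ln_1sub_sqr x : 0 <= x -> x < 1 -> ln (1 - x) <= - x - x ^+ 2 / 4.
Proof.
move=> x0 x1; rewrite ln_sqrt; last lra.
have r0 : 0 < Num.sqrt (1 - x) by rewrite sqrtr_gt0; lra.
have := ln_le_subr1 r0;
have r2 : Num.sqrt (1 - x) ^+ 2 = 1 - x by rewrite sqr_sqrtr//; lra.
move: r0 r2; move: (Num.sqrt _) => r r0 r2 h.
have r1 : r <= 1 by nra.
have ex : x = 1 - r ^+ 2 by lra.
have : (1 - r) ^+ 2 * (2 ^+ 2 - (1 + r) ^+ 2) >= 0.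
  by rewrite mulr_ge0 ?sqr_ge0//; nra.
rewrite ex; lra.
Qed.

(** A word of length [L], starting with a block of [x * L] equal letters, is cut after [l1]
    positions, past the block. The first-order terms [x * l2] of the two halves cancel; the gain is
    the quadratic term of [ln_1sub_sqr]. *)
Lemma ent_gain_mixed (L l1 l2 x : R) : 0 < L -> 0 < l1 -> 0 <= l2 -> l1 + l2 = L -> 0 <= x ->
  x < 1 -> x * L < l1 ->
  ent (2 * l1) (2 * (l1 - x * L)) + ent (2 * l2) (2 * l2) + l2 * x ^+ 2 / 2
    <= 2 * ent L (L * (1 - x)).
Proof.
move=> L0 l10 l20 e x0 x1 xl.
set t1 := l1 - x * L; have t10 : 0 < t1 by rewrite /t1; lra.
rewrite ent_diag /ent -mulf_div divff ?mul1r; last lra.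
have -> : L / (L * (1 - x)) = (1 - x)^-1.
  by rewrite invfM mulrA divff ?mul1r ?gt_eqF.
rewrite lnV ?posrE; last lra.
have h1 := ln_1sub_sqr x0 x1.
have h2 : ln (l1 / t1) + ln (1 - x) <= l1 * (1 - x) / t1 - 1.
  rewrite -lnM ?posrE ?divr_gt0//; last lra.
  have -> : l1 / t1 * (1 - x) = l1 * (1 - x) / t1 by rewrite mulrAC.
  by apply: ln_le_subr1; rewrite divr_gt0// mulr_gt0//; lra.
have h3 : t1 * (ln (l1 / t1) + ln (1 - x)) <= x * l2.
  apply: (le_trans (ler_wpM2l (ltW t10) h2)).
  rewrite mulrBr mulr1 mulrCA divff ?mulr1 ?gt_eqF//.
  by rewrite /t1 -e; lra.
have -> : L * (1 - x) = t1 + l2 by rewrite /t1 -e; ring.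
have := ler_wpM2l l20 h1; lra.
Qed.

(** Together with [ent_upper], this squeezes the entropy between quadratics in the frequency of a
    letter, so that different letters can be compared. *)
Lemma ent_lower L x : 0 < L -> 0 <= x -> x < 1 -> L * (1 - x ^+ 2) <= ent L (L * (1 - x)).
Proof.
move=> L0 x0 x1; rewrite /ent.
have -> : L / (L * (1 - x)) = (1 - x)^-1.
  by rewrite invfM mulrA divff ?mul1r ?gt_eqF.
rewrite lnV ?posrE; last lra.
have h1 := @ln_le_subr1 (1 - x).
rewrite -mulrA ler_pM2l//.
have x1' : 0 < 1 - x by lra.
have := ler_wpM2l (ltW x1') (h1 x1'); lra.
Qed.

Lemma ent_upper L y : 0 < L -> 0 <= y -> y <= 1 -> ent L (L * (1 - y)) <= L * (1 - y ^+ 2 / 4).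
Proof.
move=> L0 y0; rewrite le_eqVlt => /predU1P[->|y1].
  by rewrite subrr mulr0 ent0; nra.
rewrite /ent.
have -> : L / (L * (1 - y)) = (1 - y)^-1.
  by rewrite invfM mulrA divff ?mul1r ?gt_eqF.
rewrite lnV ?posrE; last lra.
rewrite ln_sqrt; last lra.
have r0 : 0 < Num.sqrt (1 - y) by rewrite sqrtr_gt0; lra.
have := ln_ge_1subV r0;
have r2 : Num.sqrt (1 - y) ^+ 2 = 1 - y by rewrite sqr_sqrtr//; lra.
move: r0 r2; move: (Num.sqrt _) => r r0 r2 h.
have r1 : r <= 1 by nra.
have rV : r^-1 * r = 1 by rewrite mulVf ?gt_eqF.
have ey : y = 1 - r ^+ 2 by lra.
rewrite -mulrA ler_pM2l// ey.
have : r ^+ 2 * (1 - r^-1) <= r ^+ 2 * ln r by rewrite ler_wpM2l ?sqr_ge0.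
have -> : r ^+ 2 * (1 - r^-1) = r ^+ 2 - r.
  by rewrite mulrBr mulr1 expr2 -mulrA [r * r^-1]mulrC rV mulr1.
have : (1 - r) ^+ 2 * (2 ^+ 2 - (1 + r) ^+ 2) >= 0.
  by rewrite mulr_ge0 ?sqr_ge0//; nra.
lra.
Qed.
End Entropy.

(** * Letter counts, inversions, and the weight of a word relative to a letter *)

Section Potential.
Variables (R : realType) (T : eqType).
Implicit Types (i j l : T) (p q z w : seq T).

Definition occ i z : R := (count_mem i z)%:R.
Definition nocc i z : R := (count (predC (pred1 i)) z)%:R.
Definition len z : R := (size z)%:R.

(* Sum over all pairs of positions [x < y] of [[z_y = i] - [z_x = i]];
   it vanishes on palindromes. *)
Fixpoint skew i z : R :=
  if z is a :: z' then skew i z' + occ i z' - len z' * (a == i)%:R else 0.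

Lemma occ_ge0 i z : 0 <= occ i z. Proof. exact: ler0n. Qed.
Lemma nocc_ge0 i z : 0 <= nocc i z. Proof. exact: ler0n. Qed.

Lemma occD i z : occ i z + nocc i z = len z.
Proof. by rewrite /occ /nocc -natrD count_predC. Qed.

Lemma occ_cons i a z : occ i (a :: z) = (a == i)%:R + occ i z.
Proof. by rewrite /occ /= natrD. Qed.

Lemma nocc_cons i a z : nocc i (a :: z) = (a != i)%:R + nocc i z.
Proof. by rewrite /nocc /= natrD. Qed.

Lemma len_cons a z : len (a :: z) = 1 + len z.
Proof. by rewrite /len /= -natr1 addrC. Qed.

Lemma occ_cat i p q : occ i (p ++ q) = occ i p + occ i q.
Proof. by rewrite /occ count_cat natrD. Qed.

Lemma nocc_cat i p q : nocc i (p ++ q) = nocc i p + nocc i q.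
Proof. by rewrite /nocc count_cat natrD. Qed.

Lemma len_cat p q : len (p ++ q) = len p + len q.
Proof. by rewrite /len size_cat natrD. Qed.

Lemma occ_rev i z : occ i (rev z) = occ i z.
Proof. by rewrite /occ count_rev. Qed.

Lemma nocc_rev i z : nocc i (rev z) = nocc i z.
Proof. by rewrite /nocc count_rev. Qed.

Lemma len_rev z : len (rev z) = len z.
Proof. by rewrite /len size_rev. Qed.

Lemma skew_cat i p q :
  skew i (p ++ q) = skew i p + skew i q + len p * occ i q - len q * occ i p.
Proof.
elim: p => [|a p IH] /=; first by rewrite /len /occ /=; ring.
by rewrite IH occ_cat len_cat len_cons occ_cons; ring.
Qed.

Lemma skew_rev i z : skew i (rev z) = - skew i z.
Proof.
elim: z => [|a z IH]; first by rewrite oppr0.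
rewrite rev_cons -cats1 skew_cat IH len_rev occ_rev occ_cons len_cons /=.
by rewrite /occ /len /=; ring.
Qed.

Lemma skew_pal i w : skew i (rev w ++ w) = 0.
Proof. by rewrite skew_cat skew_rev len_rev occ_rev; ring. Qed.

(** Only pairs made of an [i] and another letter contribute, each by 1 or -1. *)
Lemma skew_bound i z : `|skew i z| <= occ i z * nocc i z.
Proof.
elim: z => [|a z IH]; first by rewrite /= normr0 mulr_ge0 ?occ_ge0 ?nocc_ge0.
rewrite occ_cons nocc_cons /= -(occD i z).
move: IH (occ_ge0 i z) (nocc_ge0 i z); rewrite !ler_norml => /andP[h1 h2] h3 h4.
case: eqVneq => _ /=; rewrite ?mulr0n ?mulr1n ?add0r ?mulr1 ?mulr0 ?subr0;
  rewrite ?mulrDl ?mulrDr ?mul1r; apply/andP; split; lra.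
Qed.

Lemma nocc_nseq i a : nocc i (nseq a i) = 0.
Proof. by elim: a => [|a IH]; rewrite // nocc_cons eqxx IH addr0. Qed.

Lemma occ_nseq i a : occ i (nseq a i) = a%:R.
Proof. by have := occD i (nseq a i); rewrite nocc_nseq addr0 /len size_nseq. Qed.

Lemma occ_notin i z : i \notin z -> occ i z = 0.
Proof. by move=> /count_memPn h; rewrite /occ h. Qed.

Lemma skew_eq0 i z : occ i z * nocc i z = 0 -> skew i z = 0.
Proof. by move=> h; apply/eqP; rewrite -normr_eq0 eq_le normr_ge0 -h skew_bound. Qed.

Lemma skew_sorted i a y : i \notin y -> skew i (nseq a i ++ y) = - (a%:R * len y).
Proof.
move=> iy; rewrite skew_cat !skew_eq0 ?occ_nseq ?nocc_nseq ?mulr0 ?occ_notin ?mul0r//.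
by rewrite mulr0; ring.
Qed.

Lemma unsortedP i z :
  (exists p j q, j != i /\ z = p ++ j :: i :: q) \/
  (exists a y, i \notin y /\ z = nseq a i ++ y).
Proof.
elim: z => [|a z [[p [j [q [ji ->]]]]|[b [y [iy ->]]]]].
- by right; exists 0%N, [::].
- by left; exists (a :: p), j, q.
have [->|ai] := eqVneq a i; first by right; exists b.+1, y.
case: b => [|b]; first by right; exists 0%N, (a :: y); rewrite in_cons negb_or eq_sym ai.
by left; exists [::], a, (nseq b i ++ y).
Qed.

Variable M : R.
Hypothesis M1 : 1 <= M.

(** The weight [Psi_i]. Division by the length keeps the skew term below the number of letters other
    than [i]; on the empty word both terms are 0. *)
Definition wpot i z : R := M * ent (len z) (nocc i z) + skew i z / len z.

Lemma len_ge0 z : 0 <= len z. Proof. exact: ler0n. Qed.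

Lemma nocc_le i z : nocc i z <= len z.
Proof. by rewrite -(occD i) lerDr occ_ge0. Qed.

Lemma occ_le i z : occ i z <= len z.
Proof. by rewrite -(occD i) lerDl nocc_ge0. Qed.

Lemma skew_len_bound i z : `|skew i z / len z| <= nocc i z.
Proof.
have [l0|l0] := eqVneq (len z) 0.
  by rewrite l0 invr0 mulr0 normr0 nocc_ge0.
have lp : 0 < len z by rewrite lt_neqAle eq_sym l0 len_ge0.
rewrite normrM normfV (gtr0_norm lp) ler_pdivrMr// (le_trans (skew_bound i z))//.
by rewrite mulrC ler_wpM2l ?nocc_ge0 ?occ_le.
Qed.

Lemma pot_le i z : wpot i z <= (M + 1) * len z.
Proof.
have := skew_len_bound i z; rewrite ler_norml => /andP[_ h].
have h2 := ent_le (nocc_ge0 i z) (nocc_le i z).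
have h3 : M * ent (len z) (nocc i z) <= M * len z.
  by apply: ler_wpM2l => //; apply: le_trans M1; exact: ler01.
by rewrite /wpot mulrDl mul1r; have := nocc_le i z; lra.
Qed.

Lemma pot_pal i w : wpot i (rev w ++ w) = M * ent (2 * len w) (2 * nocc i w).
Proof.
rewrite /wpot skew_pal mul0r addr0 len_cat nocc_cat len_rev nocc_rev.
by congr (_ * ent _ _); ring.
Qed.

Lemma pot_nseq i a : wpot i (nseq a i) = 0.
Proof.
by rewrite /wpot skew_eq0 nocc_nseq ?mulr0// ent0 mulr0 mul0r addr0.
Qed.

Lemma pot_swap i j p q : j != i ->
  wpot i (p ++ i :: j :: q) = wpot i (p ++ j :: i :: q) - 2 / len (p ++ j :: i :: q).
Proof.
move=> ji; have e : len (p ++ i :: j :: q) = len (p ++ j :: i :: q).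
  by rewrite !len_cat !len_cons.
have e' : nocc i (p ++ i :: j :: q) = nocc i (p ++ j :: i :: q).
  by rewrite !nocc_cat !nocc_cons; ring.
rewrite /wpot e e' -addrA -mulrBl; congr (_ + _ / _).
rewrite !skew_cat !occ_cons !len_cons /= !occ_cons !len_cons eqxx (negbTE ji) /=; ring.
Qed.

(** A commutator replaces [j i] by one letter [l]. Neither the length nor the number of letters
    other than [i] grows, so the entropy does not either; the skew sum grows by at most the old
    length, which costs 1, and the smaller denominator costs at most 1 more. *)
Lemma pot_merge i j l p q : j != i ->
  wpot i (p ++ l :: q) <= wpot i (p ++ j :: i :: q) + 2.
Proof.
move=> ji; set z := _ ++ j :: _; set z' := _ ++ l :: _.
have ez : len z = len z' + 1 by rewrite !len_cat !len_cons; ring.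
have z'1 : 1 <= len z' by rewrite /len ler1n size_cat /= addnS.
have z0 : 0 < len z by lra.
have en : nocc i z' <= nocc i z.
  rewrite !nocc_cat !nocc_cons ji eqxx /=.
  by case: (l != i) => /=; have := nocc_ge0 i q; lra.
have h1 : ent (len z') (nocc i z') <= ent (len z) (nocc i z).
  apply: (@le_trans _ _ (ent (len z) (nocc i z'))).
    by apply: le_entl; [exact: nocc_ge0|exact: nocc_le|lra].
  by apply: le_entr; [exact: nocc_ge0|by []|exact: nocc_le].
have h2 : skew i z' <= skew i z + len z.
  have b1 := occ_le i p; have b2 := occ_le i q.
  have b3 := occ_ge0 i p; have b4 := occ_ge0 i q.
  have b5 := len_ge0 p; have b6 := len_ge0 q.
  rewrite /z /z' !skew_cat !occ_cons len_cat !len_cons /= !occ_cons !len_cons eqxx (negbTE ji) /=.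
  by case: (l == i) => /=; lra.
have h3 : skew i z' / len z' <= skew i z / len z + 2.
  have -> : skew i z' / len z' = skew i z' / len z + (skew i z' / len z') / len z.
    by rewrite ez; field; apply/andP; split; rewrite gt_eqF; lra.
  have h4 : skew i z' / len z <= skew i z / len z + 1.
    by rewrite -[1](@divff _ (len z)) ?gt_eqF// -mulrDl ler_pM2r ?invr_gt0.
  have h5 : (skew i z' / len z') / len z <= 1.
    rewrite ler_pdivrMr// mul1r.
    have := skew_len_bound i z'; rewrite ler_norml => /andP[_ h].
    by have := nocc_le i z'; lra.
  lra.
rewrite /wpot; have : M * ent (len z') (nocc i z') <= M * ent (len z) (nocc i z).
  by apply: ler_wpM2l => //; apply: le_trans M1; exact: ler01.
lra.
Qed.
End Potential.

(** * Weights of different letters at one word, and the cut of a sorted word *)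

Lemma sum_count_mem (n : nat) (w : seq 'I_n) : (\sum_(j < n) count_mem j w)%N = size w.
Proof.
elim: w => [|a w IH] /=; first by rewrite big1.
by rewrite big_split /= IH (bigD1 a) //= eqxx big1 ?addn0// => l /negbTE; rewrite eq_sym => ->.
Qed.

Section Words.
Variables (R : realType) (n : nat).
Implicit Types (i j l : 'I_n) (p q z w : seq 'I_n).

(* Large enough for the entropy to dominate the skew term, also when no letter is predominant. *)
Local Notation M := (32 * n%:R ^+ 2 : R).
Local Notation pot := (@wpot R _ M).
Local Notation occ := (occ R).
Local Notation nocc := (nocc R).
Local Notation len := (len R).

Lemma M_ge32 : (0 < n)%N -> 32 <= M.
Proof.
move=> n0; have : 1 <= n%:R ^+ 2 :> R by rewrite -natrX ler1n expn_gt0 n0.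
lra.
Qed.

Lemma frequent_letter z : (0 < n)%N -> exists j, len z <= n%:R * occ j z.
Proof.
move=> n0; have [j _ hj] := @arg_maxnP _ (Ordinal n0) xpredT (fun j => count_mem j z) isT.
exists j; rewrite -natrM ler_nat.
rewrite -[in leqLHS](sum_count_mem z) -[X in (X * _)%N]card_ord -sum_nat_const.
by rewrite leq_sum// => l _; exact: hj.
Qed.

(** A letter of least weight cannot be rare. Compare with a letter of frequency [y >= 1 / n]: each
    skew term costs at most a quarter of the length, so [M * x ^ 2 >= M * y ^ 2 / 4 - 1 / 2 >= 15 /
    2]. *)
Lemma minimal_freq i z (x : R) : 0 < len z -> occ i z = x * len z -> x < 1 ->
  - (occ i z * nocc i z) <= skew R i z -> (forall j, pot i z <= pot j z) -> 8 < M * x.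
Proof.
move=> L0 ex x1 hs hmin.
have n0 : (0 < n)%N by case: n i {hmin hs ex} => // -[].
have x0 : 0 <= x by rewrite -(pmulr_lge0 _ L0) -ex occ_ge0.
have [j hj] := frequent_letter z n0.
have := hmin j; rewrite /wpot.
have ej : exists y, occ j z = y * len z by exists (occ j z / len z); rewrite divfK ?gt_eqF.
have [y ey] := ej.
have nx : nocc i z = len z * (1 - x) by have := occD R i z; rewrite ex; lra.
have ny : nocc j z = len z * (1 - y) by have := occD R j z; rewrite ey; lra.
have y0 : 0 <= y by rewrite -(pmulr_lge0 _ L0) -ey occ_ge0.
have y1 : y <= 1 by have := nocc_ge0 R j z; rewrite ny pmulr_rge0//; lra.
have hny : 1 <= n%:R * y.
  by rewrite -(ler_pM2r L0) mul1r -mulrA -ey.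
have h1 := ent_lower L0 x0 x1.
have h2 := ent_upper L0 y0 y1.
have hsj : skew R j z <= occ j z * nocc j z.
  by have := skew_bound R j z; rewrite ler_norml => /andP[].
have q1 : - (len z / 4) <= skew R i z / len z.
  by rewrite ler_pdivlMr//; apply: le_trans hs; rewrite nx ex;
  have := sqr_ge0 (len z * (2^-1 - x)); lra.
have q2 : skew R j z / len z <= len z / 4.
  by rewrite ler_pdivrMr//; apply: (le_trans hsj); rewrite ny ey;
  have := sqr_ge0 (len z * (2^-1 - y)); lra.
have M32 := M_ge32 n0.
rewrite nx ny => hm.
have k1 : M * (len z * (1 - x ^+ 2)) <= M * ent (len z) (len z * (1 - x)).
  by rewrite ler_wpM2l//; lra.
have k2 : M * ent (len z) (len z * (1 - y)) <= M * (len z * (1 - y ^+ 2 / 4)).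
  by rewrite ler_wpM2l//; lra.
have k3 : len z * (M * y ^+ 2 / 4 - 2^-1) <= len z * (M * x ^+ 2) by lra.
move: k3; rewrite ler_pM2l// => k3.
have k4 : 1 <= (n%:R * y) ^+ 2 by rewrite exprn_ege1.
have k5 : 15 / 2 <= M * x ^+ 2 by apply: le_trans k3; rewrite exprMn in k4; lra.
(* Hence [(M * x) ^ 2 >= 240], which exceeds [8 ^ 2]. *)
have k6 : 32 * (15 / 2) <= M * (M * x ^+ 2) by rewrite ler_pM//; lra.
have k7 : 0 <= M * x by rewrite mulr_ge0//; lra.
rewrite ltNge; apply/negP => hle.
have : (M * x) * (M * x) <= 8 * 8 by rewrite ler_pM.
lra.
Qed.

(* At a word sorted with the letter [i] first, strict concavity of [ent] beats the skew term. *)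
Lemma pot_split i p q a y : (0 < size p)%N -> (size p <= size q <= (size p).+1)%N ->
  p ++ q = nseq a i ++ y -> i \notin y -> (0 < size y)%N ->
  (forall j, pot i (p ++ q) <= pot j (p ++ q)) ->
  pot i (p ++ rev p) + pot i (rev q ++ q) < 2 * pot i (p ++ q).
Proof.
move=> p0 /andP[pq qp] e iy y0 hmin.
have n0 : (0 < n)%N by case: n i {hmin e iy} => // -[].
have M32 := M_ge32 n0.
have oc : occ i (p ++ q) = a%:R by rewrite e occ_cat occ_nseq occ_notin// addr0.
have noc : nocc i (p ++ q) = len y.
  by rewrite e nocc_cat nocc_nseq add0r; have := occD R i y; rewrite occ_notin// add0r.
have sk : skew R i (p ++ q) = - (a%:R * len y) by rewrite e skew_sorted.
have eL : len (p ++ q) = a%:R + len y by rewrite -(occD R i) oc noc.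
have p0' : 0 < len p by rewrite /len ltr0n.
have y0' : 0 < len y by rewrite /len ltr0n.
have pq' : len p <= len q by rewrite /len ler_nat.
have qp' : len q <= len p + 1 by rewrite /len natr1 ler_nat.
have p1' : 1 <= len p by rewrite /len ler1n.
have epq := len_cat R p q.
have a0 : 0 <= a%:R :> R by exact: ler0n.
have L0 : 0 < len (p ++ q) by lra.
have -> : pot i (p ++ rev p) = M * ent (2 * len p) (2 * nocc i p).
  by rewrite -{1}(revK p) pot_pal len_rev nocc_rev.
rewrite pot_pal {1}/wpot sk noc.
have ep : p = take (size p) (nseq a i ++ y) by rewrite -e take_size_cat.
have eq : q = drop (size p) (nseq a i ++ y) by rewrite -e drop_size_cat.
have nocpq := nocc_cat R i p q.
set x := a%:R / len (p ++ q).
have xL : x * len (p ++ q) = a%:R by rewrite divfK ?gt_eqF.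
have x0 : 0 <= x by rewrite divr_ge0// ltW.
have -> : - (a%:R * len y) / len (p ++ q) = - (x * len y) by rewrite mulNr mulrAC.
have x1 : x < 1 by rewrite ltr_pdivrMr// mul1r; lra.
(* If the cut does not pass the block of [i], the first half is a power of [i] and weighs nothing;
   the gain [2 * M * len y / 3] beats the skew contribution, at most [2 * len y]. *)
have [pa|ap] := leqP (size p) a.
  have nocp : nocc i p = 0.
    rewrite ep take_cat size_nseq; case: ltnP => [_|ap].
      by rewrite take_nseq ?nocc_nseq// ltnW.
    have -> : size p = a by apply/eqP; rewrite eqn_leq pa.
    by rewrite subnn take0 cats0 nocc_nseq.
  have nocq : nocc i q = len y by lra.
  rewrite nocp nocq mulr0 ent0 mulr0 add0r.
  have ylq : len y <= len q by have : len p <= a%:R by [rewrite /len ler_nat]; lra.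
  (* [len q <= len p + 1 <= 2 * len p], as [p] is nonempty. *)
  have l3 : 3 * len q <= 2 * len (p ++ q) by lra.
  have h := ent_gain_pure y0' ylq l3.
  have h' : M * (ent (2 * len q) (2 * len y) + 2 * len y / 3)
      <= M * (2 * ent (len (p ++ q)) (len y)).
    by apply: ler_wpM2l => //; lra.
  have h2 : x * len y <= 1 * len y by rewrite ler_wpM2r// ltW.
  have h3 : 32 * len y <= M * len y by rewrite ler_wpM2r// ltW.
  lra.
have nocp : nocc i p = len p - x * len (p ++ q).
  rewrite xL; have := occD R i p; suff -> : occ i p = a%:R by lra.
  rewrite ep take_cat size_nseq ltnNge (ltnW ap) /= occ_cat occ_nseq occ_notin ?addr0//.
  by apply: contra iy => /mem_take.
have nocq : nocc i q = len q by lra.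
have ap' : a%:R < len p by rewrite /len ltr_nat.
have ey : len y = len (p ++ q) * (1 - x) by lra.
(* The gain [M * len q * x ^ 2 / 2] has to beat [2 * x * len y <= 4 * x * len q]; hence the constant
   8. *)
have Mx : 8 < M * x.
  apply: (@minimal_freq i (p ++ q)) => //; first by rewrite oc xL.
  by rewrite sk oc noc.
have xpos : 0 < x by rewrite lt_neqAle x0 andbT; apply/eqP => x00; move: Mx; rewrite -x00; lra.
have q0 : 0 <= len q by lra.
have xlp : x * len (p ++ q) < len p by rewrite xL.
have h := ent_gain_mixed L0 p0' q0 (esym epq) x0 x1 xlp.
rewrite nocp nocq {1}ey.
have M0 : 0 <= M by lra.
have h' := ler_wpM2l M0 h.
have h2 : x * len y <= x * (2 * len q) by rewrite ler_wpM2l//; lra.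
have h3 : 8 * (len q * x) < M * x * (len q * x).
  by rewrite ltr_pM2r// mulr_gt0//; lra.
lra.
Qed.
End Words.

(** * Recursion on the length for a function of words with exchange and Cauchy-Schwarz
    inequalities *)

Section Recursion.
Variables (R : realType) (n : nat) (F : seq 'I_n -> R) (K : R).
Implicit Types (i j l : 'I_n) (p q z w : seq 'I_n) (N Y : R).

Hypothesis F_ge0 : forall z, 0 <= F z.
Hypothesis K_ge0 : 0 <= K.
Hypothesis F_swap : forall p i j q,
  F (p ++ j :: i :: q) <= F (p ++ i :: j :: q) + K * \sum_(l < n) F (p ++ l :: q).
Hypothesis F_cauchy : forall p q,
  F (p ++ q) ^+ 2 <= F (p ++ rev p) * F (rev q ++ q).

Local Notation M := (32 * n%:R ^+ 2 : R).
Local Notation pot := (@wpot R _ M).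

(** For [n > 0], the maximum [N k] of the opening idea is the least such [N]. *)
Definition dominated N k := forall z i, size z = k -> F z <= N * expR (pot i z).

(** An exchange creates [n] shorter words; [expR 2] bounds the effect of [pot_merge] on each. *)
Definition kappa := K * n%:R * expR 2.

Lemma kappa_ge0 : 0 <= kappa.
Proof. by rewrite !mulr_ge0 ?expR_ge0. Qed.

Lemma ex_sharp_dominated k : (0 < n)%N ->
  exists N z i, [/\ size z = k, F z = N * expR (pot i z), 0 <= N & dominated N k].
Proof.
move=> n0; pose f (x : k.-tuple 'I_n * 'I_n) := F x.1 * expR (- pot x.2 x.1).
have [[z i] _ h] := @arg_maxP _ _ _ (nseq_tuple k (Ordinal n0), Ordinal n0) xpredT f isT.
exists (f (z, i)), z, i; split; first exact: size_tuple.
- by rewrite /f /= -mulrA -expRD addNr expR0 mulr1.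
- by rewrite mulr_ge0 ?expR_ge0.
move=> z' i' sz; have /eqP sz' := sz.
have := h (Tuple sz', i') isT; rewrite /= {1}/f /= => hle.
by rewrite -(ler_pM2r (expR_gt0 (- pot i' z'))) -[X in _ <= X]mulrA -expRD addrN expR0 mulr1.
Qed.

(** The exchange lowers the weight by [2 / k], so maximality gives
    [N <= N * exp (- 2 / k) + kappa * N'], and [1 - exp (- 2 / k) >= 1 / k]. *)
Lemma unsorted_step k N N' p q i j : (1 < k)%N -> j != i ->
  size (p ++ j :: i :: q) = k -> 0 <= N ->
  F (p ++ j :: i :: q) = N * expR (pot i (p ++ j :: i :: q)) ->
  dominated N k -> dominated N' k.-1 -> 0 <= N' -> N <= kappa * k%:R * N'.
Proof.
move=> k1 ji sz N0 eF hN hN' N'0.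
have n0 : (0 < n)%N by case: n i {hN hN' ji sz eF} => // -[].
have M1 : 1 <= M by have := M_ge32 R n0; lra.
set z := p ++ j :: i :: q in sz eF *.
have lz : len R z = k%:R by rewrite /len sz.
have h1 : F (p ++ i :: j :: q) <= N * expR (pot i z) * expR (- (2 / k%:R)).
  rewrite -mulrA -expRD -lz -pot_swap//; apply: hN.
  by rewrite -sz !size_cat.
have h2 l : F (p ++ l :: q) <= N' * (expR (pot i z) * expR 2).
  apply: (@le_trans _ _ (N' * expR (pot i (p ++ l :: q)))).
    by apply: hN'; rewrite -sz !size_cat /= !addnS.
  by rewrite ler_wpM2l// -expRD ler_expR; exact: pot_merge.
have h3 : K * \sum_(l < n) F (p ++ l :: q) <= kappa * N' * expR (pot i z).
  have -> : kappa * N' * expR (pot i z) = K * (n%:R * (N' * (expR (pot i z) * expR 2))).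
    by rewrite /kappa; ring.
  rewrite ler_wpM2l//; apply: (le_trans (ler_sum _ (fun l _ => h2 l))).
  by rewrite sumr_const card_ord -[leLHS]mulr_natl.
have := F_swap p i j q; rewrite -/z eF => h4.
have {h1 h3}h4 : N * expR (pot i z) <= (N * expR (- (2 / k%:R)) + kappa * N') * expR (pot i z).
  by apply: (le_trans h4); rewrite mulrDl mulrAC lerD.
move: h4; rewrite ler_pM2r ?expR_gt0// => h4.
have k2 : 2 <= k%:R :> R by rewrite ler_nat.
(* With [v = 1 / k <= 1 / 2]: [exp (- 2 v) <= 1 / (1 + 2 v) <= 1 - v]. *)
have h5 : expR (- (2 / k%:R)) <= 1 - k%:R^-1 :> R.
  have e1 := expR_ge1Dx (2 / k%:R : R).
  have kV : k%:R * k%:R^-1 = 1 :> R by rewrite divff//; apply: lt0r_neq0; lra.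
  have v0 : 0 < k%:R^-1 :> R by rewrite invr_gt0; lra.
  move: e1 kV v0; set v := k%:R^-1 => e1 kV v0.
  have v2 : v <= 2^-1 by nra.
  rewrite expRN -[leLHS]mulr1 ler_pdivrMl ?expR_gt0//.
  apply: (@le_trans _ _ ((1 + 2 * v) * (1 - v))); first by nra.
  by rewrite ler_wpM2r//; lra.
have h6 := ler_wpM2l N0 h5.
have h7 : N / k%:R <= kappa * N' by lra.
by move: h7; rewrite ler_pdivrMr; [rewrite mulrAC|lra].
Qed.

(** For a sorted word that is not a power of [i], the cut at [k] and Cauchy-Schwarz lead to
    palindromes of lengths [2k] and [2l]; [pot_split] makes the resulting bound strict. *)
Lemma dominated_trichotomy k (l : nat) N N' Na Nb z i : (0 < k)%N -> (k <= l <= k.+1)%N ->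
  size z = (k + l)%N -> 0 < N -> F z = N * expR (pot i z) -> dominated N (k + l) ->
  0 <= N' -> dominated N' (k + l).-1 -> 0 <= Na -> dominated Na k.*2 ->
  0 <= Nb -> dominated Nb l.*2 ->
  [\/ N <= kappa * (k + l)%:R * N', z = nseq (k + l) i | N ^+ 2 < Na * Nb].
Proof.
move=> k0 kl sz N0 eF hN N'0 hN' Na0 hNa Nb0 hNb.
have [[p [j [q [ji ez]]]]|[a [y [iy ez]]]] := unsortedP i z.
  apply: Or31; rewrite ez in sz eF.
  by apply: (unsorted_step _ ji sz (ltW N0) eF hN hN' N'0); lia.
case: y iy ez => [|b y] iy ez.
  by apply: Or32; move: ez sz; rewrite cats0 => ->; rewrite size_nseq => ->.
apply: Or33.
(* The pair is maximal also in its letter: at the word [z], the letter [i] has least weight. *)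
have hmin j : pot i z <= pot j z.
  by have := hN z j sz; rewrite eF ler_pM2l// ler_expR.
have sp : size (take k z) = k by rewrite size_takel// sz leq_addr.
have sq : size (drop k z) = l by rewrite size_drop sz addKn.
have h := @pot_split R n i (take k z) (drop k z) a (b :: y).
rewrite sp sq cat_take_drop in h.
have {}h := h k0 kl ez iy isT hmin.
have := F_cauchy (take k z) (drop k z); rewrite cat_take_drop eF => h1.
have h2 := hNa (take k z ++ rev (take k z)) i; rewrite size_cat size_rev sp addnn in h2.
have {}h2 := h2 erefl.
have h3 := hNb (rev (drop k z) ++ drop k z) i; rewrite size_cat size_rev sq addnn in h3.
have {}h3 := h3 erefl.
have {h2 h3}h4 := le_trans h1 (ler_pM (F_ge0 _) (F_ge0 _) h2 h3).
rewrite mulrACA -expRD exprMn -expRM_natl in h4.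
have NN : 0 < N ^+ 2 by rewrite exprn_gt0.
have e0 := expR_gt0 (2%:R * pot i z).
(* A zero product would spoil strictness; it is excluded by [0 < F z]. *)
have NaNb : 0 < Na * Nb.
  rewrite lt_neqAle mulr_ge0// andbT; apply/eqP => e.
  by move: h4; rewrite -e mul0r leNgt mulr_gt0.
rewrite -(ltr_pM2r e0); apply: (le_lt_trans h4).
by rewrite ltr_pM2l// ltr_expR.
Qed.

(** Write [a] for [kappa * (2k + 2)]. At length [2k + 2] the halves are equal and the third case
    reads [X ^ 2 < X * X], so [X <= a * N] or the word is a power. At length [2k + 1], halves [k]
    and [k + 1] give [N <= a * Y] or [N ^ 2 <= Y * X]. Both yield [X <= a ^ 2 * Y]. *)
Lemma even_step k Y : (0 < k)%N -> (0 < n)%N -> 0 <= Y -> dominated Y k.*2 ->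
  exists X, [/\ 0 <= X, dominated X k.+1.*2 &
    X <= (kappa * k.+1.*2%:R) ^+ 2 * Y \/ exists i, X <= F (nseq k.+1.*2 i)].
Proof.
move=> k0 n0 Y0 hY.
have [X [z [i [sz eF X0 hX]]]] := ex_sharp_dominated k.+1.*2 n0.
exists X; split=> //.
have [->|Xn] := eqVneq X 0; first by left; rewrite mulr_ge0// sqr_ge0.
have Xp : 0 < X by rewrite lt_neqAle eq_sym Xn.
have e2 : (k.+1 + k.+1 = k.+1.*2)%N by rewrite addnn.
have e1 : (k + k.+1 = k.*2.+1)%N by lia.
have [N [y [j [sy eN N0 hN]]]] := ex_sharp_dominated k.*2.+1 n0.
have hN' : N <= kappa * k.+1.*2%:R * Y \/ N ^+ 2 <= Y * X.
  have [->|Nn] := eqVneq N 0; first by right; rewrite expr0n mulr_ge0.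
  have Np : 0 < N by rewrite lt_neqAle eq_sym Nn.
  have := @dominated_trichotomy k k.+1 N Y Y X y j k0.
  rewrite leqnSn leqnn e1 => /(_ isT sy Np eN hN Y0 hY Y0 hY X0 hX)[h|ey|h].
  - left; apply: (le_trans h); rewrite ler_wpM2r// ler_wpM2l ?kappa_ge0 ?expR_ge0// ler_nat; lia.
  - right; move: eN; rewrite ey pot_nseq expR0 mulr1 => <-.
    have := F_cauchy (nseq k j) (nseq k.+1 j).
    rewrite !rev_nseq !cat_nseq /ncons -!iterD e1 e2 addnn => h.
    have a1 := hY (nseq k.*2 j) j; rewrite size_nseq pot_nseq expR0 mulr1 in a1.
    have a2 := hX (nseq k.+1.*2 j) j; rewrite size_nseq pot_nseq expR0 mulr1 in a2.
    exact: le_trans h (ler_pM (F_ge0 _) (F_ge0 _) (a1 erefl) (a2 erefl)).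
  - by right; exact: ltW.
have := @dominated_trichotomy k.+1 k.+1 X N X X z i isT.
rewrite leqnSn leqnn e2 => /(_ isT sz Xp eF hX N0 hN X0 hX X0 hX)[h|ez|].
- left; set a := kappa * _ in h hN' *.
  have a0 : 0 <= a by rewrite mulr_ge0 ?kappa_ge0.
  clearbody a.
  case: hN' => h'; first by apply: (le_trans h); rewrite expr2 -mulrA ler_wpM2l.
  rewrite -(ler_pM2r Xp); apply: (@le_trans _ _ ((a * N) ^+ 2)).
    by rewrite -expr2 lerXn2r ?nnegrE ?(mulr_ge0 a0).
  by rewrite exprMn -[leRHS]mulrA ler_wpM2l ?sqr_ge0.
- by right; exists i; move: eF; rewrite ez pot_nseq expR0 mulr1 => <-.
- by rewrite expr2 ltxx.
Qed.

Lemma word_growth (m : nat -> R) (A C L0 : R) : (forall r, 0 < m r) -> m 1%N = 1 ->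
  (forall r, (1 <= r)%N -> r%:R * m r.-1 <= L0 * m r) -> 0 <= L0 -> 0 < A -> 0 < C ->
  (forall i k, (0 < k)%N -> F (nseq k.*2 i) <= (C * A ^+ k * m k) ^+ 2) ->
  exists A' C', [/\ 0 < A', 0 < C' & forall w, (0 < size w)%N ->
    F (rev w ++ w) <= (C' * A' ^+ size w * m (size w)) ^+ 2].
Proof.
move=> m0 m1 hL L00 A0 C0 hF.
have [n0|n0] := posnP n.
  exists 1, 1; split=> // -[|i w] // _.
  by case: i => i h; exfalso; move: h; rewrite n0.
have [N [_ [_ [_ _ N0 hN]]]] := ex_sharp_dominated 2 n0.
(* [c] covers [C] and the initial maximum [N] at length 2. [B] covers the rate [A] and the factor
   [2 * kappa * L0] left once [r * m (r - 1) <= L0 * m r] has absorbed the length. Both are at least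
   1, so [N <= (c * B) ^ 2]. *)
pose c := C + N + 1; pose B := A + 2 * kappa * L0 + 1.
have kL : 0 <= 2 * kappa * L0 by rewrite !mulr_ge0 ?kappa_ge0 ?expR_ge0.
have c1 : 1 <= c by rewrite /c; lra.
have B1 : 1 <= B by rewrite /B; lra.
have c0 : 0 <= c by lra.
have B0 : 0 <= B by lra.
have le_sqr (s t : R) : 0 <= s -> s <= t -> s ^+ 2 <= t ^+ 2.
  by move=> s0 st; rewrite lerXn2r ?nnegrE// (le_trans s0).
have key k : dominated ((c * B ^+ k.+1 * m k.+1) ^+ 2) k.+1.*2.
  elim: k => [|k IH] z i sz.
    apply: (le_trans (hN z i sz)); rewrite ler_wpM2r ?expR_ge0//.
    rewrite m1 mulr1 expr1.
    have h1 : c <= c * B by rewrite ler_peMr//; lra.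
    have h2 : c * B <= (c * B) ^+ 2 by rewrite expr2 ler_peMl//; lra.
    by move: h1 h2; rewrite /c; lra.
  have [X [X0 hX hX']] := even_step (ltn0Sn k) n0 (sqr_ge0 _) IH.
  apply: (le_trans (hX z i sz)); rewrite ler_wpM2r ?expR_ge0//.
  have Bk : 0 <= B ^+ k.+1 by rewrite exprn_ge0//; lra.
  case: hX' => [h|[j h]]; apply: (le_trans h).
    rewrite -exprMn; apply: le_sqr.
      by rewrite !mulr_ge0 ?kappa_ge0 ?expR_ge0 ?exprn_ge0 ?(ltW (m0 _)).
    have := hL k.+2 isT; rewrite /= => h1.
    have h2 : kappa * k.+2.*2%:R * m k.+1 <= B * m k.+2.
      have -> : kappa * k.+2.*2%:R * m k.+1 = 2 * kappa * (k.+2%:R * m k.+1).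
        by rewrite -muln2 natrM; ring.
      apply: (@le_trans _ _ (2 * kappa * (L0 * m k.+2))).
        by rewrite ler_wpM2l// mulr_ge0 ?kappa_ge0 ?expR_ge0.
      by rewrite mulrA ler_wpM2r ?(ltW (m0 _))// /B; lra.
    have -> : kappa * k.+2.*2%:R * (c * B ^+ k.+1 * m k.+1)
      = c * B ^+ k.+1 * (kappa * k.+2.*2%:R * m k.+1) by ring.
    have -> : c * B ^+ k.+2 * m k.+2 = c * B ^+ k.+1 * (B * m k.+2) by rewrite exprSr; ring.
    by rewrite ler_wpM2l// mulr_ge0.
  apply: (le_trans (hF j k.+2 isT)).
  apply: le_sqr; first exact: (mulr_ge0 (mulr_ge0 (ltW C0) (exprn_ge0 _ (ltW A0))) (ltW (m0 _))).
  apply: ler_wpM2r; first exact: ltW.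
  apply: ler_pM; [exact: ltW|exact: exprn_ge0 (ltW A0)|by rewrite /c; lra|].
  by apply: lerXn2r; rewrite ?nnegrE ?(ltW A0)// /B; lra.
(* The palindrome has length [2 * size w], so its weight costs at most the square of
   [expR (M + 1) ^+ size w]. *)
exists (B * expR (M + 1)), c; split; [by rewrite mulr_gt0 ?expR_gt0//; lra|lra|].
move=> [|i w] // _; set v := i :: w.
have sv : size (rev v ++ v) = (size w).+1.*2 by rewrite size_cat size_rev addnn.
apply: (le_trans (key (size w) _ i sv)).
have M1 : 1 <= M by have := M_ge32 R n0; lra.
apply: (@le_trans _ _ ((c * B ^+ size v * m (size v)) ^+ 2 * expR ((M + 1) * len R (rev v ++ v)))).
  by rewrite ler_wpM2l ?sqr_ge0// ler_expR pot_le.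
rewrite /len sv -muln2 expRM_natr exprM -[(size w).+1]/(size v) [(B * _) ^+ _]exprMn.
by rewrite le_eqVlt; apply/orP; left; apply/eqP; ring.
Qed.
End Recursion.

(** * Inner products and the Cauchy-Schwarz inequality *)

Section InnerProduct.
Variables (R : realType) (V : lmodType R[i]) (ip : V -> V -> R[i]).
Hypothesis hip : is_inner_product ip.
Local Notation normc := (@Normc.normc R).

Lemma ipDl u v w : ip (u + v) w = ip u w + ip v w.
Proof. by have [h _ _ _] := hip; rewrite -[u in LHS]scale1r h mul1r. Qed.

Lemma ip0l w : ip 0 w = 0.
Proof. by apply: (addrI (ip 0 w)); rewrite -ipDl !addr0. Qed.

Lemma ipZl a u w : ip (a *: u) w = a * ip u w.
Proof. by have [h _ _ _] := hip; rewrite -[a *: u]addr0 h ip0l addr0. Qed.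

Lemma ip_conj u v : ip v u = conjc (ip u v).
Proof. by have [_ h _ _] := hip. Qed.

Lemma ip_self u : ip u u = ((hnorm ip u ^+ 2)%:C)%C /\ 0 <= hnorm ip u.
Proof.
have [_ _ h _] := hip; have := h u; rewrite /hnorm.
case: (ip u u) => a b; rewrite lecE /= => /andP[/eqP -> a0].
by rewrite sqr_sqrtr// sqrtr_ge0.
Qed.

Lemma normc_real (x : R) : normc (x%:C)%C = `|x|.
Proof. by rewrite /= expr0n /= addr0 sqrtr_sqr. Qed.

Lemma normc_self u : normc (ip u u) = hnorm ip u ^+ 2.
Proof. by have [-> _] := ip_self u; rewrite normc_real ger0_norm ?sqr_ge0. Qed.

Lemma hnorm_ge0 u : 0 <= hnorm ip u. Proof. by have [] := ip_self u. Qed.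

Lemma mul_conjc (c : R[i]) : c * conjc c = ((normc c ^+ 2)%:C)%C.
Proof.
case: c => a b; rewrite /= sqr_sqrtr ?addr_ge0 ?sqr_ge0//.
by apply/eqP; rewrite eq_complex /=; apply/andP; split; apply/eqP; ring.
Qed.

Lemma cauchy_schwarz u v : normc (ip u v) <= hnorm ip u * hnorm ip v.
Proof.
have [_ _ pos def] := hip.
have [ev v0] := ip_self v; have [eu u0] := ip_self u.
have [b0|bn] := eqVneq (hnorm ip v) 0.
  have -> : v = 0 by apply: def; rewrite ev b0 expr0n.
  by rewrite ip_conj ip0l conjc0 Normc.normc0 mulr_ge0// hnorm_ge0.
have bp : 0 < hnorm ip v by rewrite lt_neqAle eq_sym bn.
set c := ip u v; set a := hnorm ip u ^+ 2; set b := hnorm ip v ^+ 2.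
(* [w] is [||v|| ^ 2] times the component of [u] orthogonal to [v]; the claim is [0 <= <w, w>]. *)
pose w := (b%:C)%C *: u + (- c) *: v.
have wv : ip w v = 0 by rewrite ipDl !ipZl ev -/c -/b; ring.
have wu : ip w u = ((b * a - normc c ^+ 2)%:C)%C.
  rewrite ipDl !ipZl (ip_conj u v) eu -/c -/a mulNr mul_conjc.
  by apply/eqP; rewrite eq_complex /=; apply/andP; split; apply/eqP; ring.
have ww : ip w w = ((b * (b * a - normc c ^+ 2))%:C)%C.
  rewrite {1}/w ipDl !ipZl (ip_conj w u) (ip_conj w v) wv wu conjc_real conjc0 mulr0 addr0.
  by apply/eqP; rewrite eq_complex /=; apply/andP; split; apply/eqP; ring.
have := pos w; rewrite ww ler0c pmulr_rge0 ?exprn_gt0// subr_ge0.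
rewrite /a /b -exprMn mulrC ler_pXn2r// ?nnegrE ?mulr_ge0//.
by rewrite /c; case: (ip u v) => ? ?; exact: sqrtr_ge0.
Qed.
End InnerProduct.

(** * Words in the operators and their coefficients [|<X_z u, u>|] *)

Section OperatorWords.
Variables (R : realType) (V : lmodType R[i]) (ip : V -> V -> R[i]) (n : nat).
Variables (dom : 'I_n -> V -> Prop) (X : 'I_n -> V -> V) (D : V -> Prop).
Hypothesis hip : is_inner_product ip.
Hypothesis hop : forall j, is_operator (dom j) (X j).
Hypothesis hsym :
  forall j, is_hermitian ip (dom j) (X j) \/ is_skew_hermitian ip (dom j) (X j).
Hypothesis hD : common_invariant_domain dom X D.
Local Notation normc := (@Normc.normc R).

Lemma wapply_cat p q (u : V) : wapply X (p ++ q) u = wapply X p (wapply X q u).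
Proof. by elim: p => //= i p ->. Qed.

Lemma wapply_nseq k j (u : V) : wapply X (nseq k j) u = iter k (X j) u.
Proof. by elim: k => //= k ->. Qed.

Lemma wapply_dom w u : D u -> D (wapply X w u).
Proof. by move=> Du; elim: w => //= i w IH; have [] := hD i IH. Qed.

Lemma wdom_all w u : D u -> wdom dom X w u.
Proof.
move=> Du; elim: w => //= i w IH; split=> //.
by have [] := hD i (wapply_dom w Du).
Qed.

Lemma Cinf1_dom j u : D u -> Cinf1 (dom j) (X j) u.
Proof.
move=> Du; elim=> //= k IH; split=> //.
by rewrite -wapply_nseq; have [] := hD j (wapply_dom (nseq k j) Du).
Qed.

Lemma operator_sum j (r : seq 'I_n) (d : V) (c : 'I_n -> R[i]) (e : 'I_n -> V) :
  dom j d -> (forall k, dom j (e k)) ->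
  dom j (d + \sum_(k <- r) c k *: e k) /\
  X j (d + \sum_(k <- r) c k *: e k) = X j d + \sum_(k <- r) c k *: X j (e k).
Proof.
move=> dd de; elim: r => [|a r [IH1 IH2]]; first by rewrite !big_nil !addr0.
have [_ h] := hop j; have [h1 h2] := h (c a) _ _ (de a) IH1.
by rewrite !big_cons !(addrCA _ (c a *: _)) h2 IH2.
Qed.

(** [D] is only an invariant set, so the combination may lie outside it. Each letter still acts
    linearly, since [dom i] is a subspace containing every vector that occurs. *)
Lemma wapply_sum p (d : V) (c : 'I_n -> R[i]) (e : 'I_n -> V) :
  D d -> (forall k, D (e k)) ->
  wapply X p (d + \sum_k c k *: e k) = wapply X p d + \sum_k c k *: wapply X p (e k).
Proof.
move=> Dd De; elim: p => //= i p ->.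
by have [] := operator_sum (index_enum _) c (proj1 (hD i (wapply_dom p Dd)))
  (fun k => proj1 (hD i (wapply_dom p (De k)))).
Qed.

(** The letters cross the inner product one by one, the first letter first, each up to a sign that
    the modulus forgets. *)
Lemma normc_adjoint w (v u : V) : D v -> D u ->
  normc (ip (wapply X w v) u) = normc (ip v (wapply X (rev w) u)).
Proof.
move=> Dv; elim: w u => //= i w IH u Du.
have [du Dxu] := hD i Du; have [dw _] := hD i (wapply_dom w Dv).
rewrite rev_cons -cats1 wapply_cat -IH//.
by case: (hsym i) => -> //; case: (ip _ _) => a b; rewrite /= !sqrrN.
Qed.

Variable u : V.
Hypothesis Du : D u.

Definition coeff w := normc (ip (wapply X w u) u).

Lemma coeff_ge0 w : 0 <= coeff w.
Proof. by rewrite /coeff; case: (ip _ _) => ? ?; exact: sqrtr_ge0. Qed.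

Lemma coeff_pal w : coeff (rev w ++ w) = hnorm ip (wapply X w u) ^+ 2.
Proof.
rewrite /coeff wapply_cat normc_adjoint ?revK//; last exact: wapply_dom.
exact: normc_self.
Qed.

Lemma coeff_cauchy p q :
  coeff (p ++ q) ^+ 2 <= coeff (p ++ rev p) * coeff (rev q ++ q).
Proof.
rewrite -{2}(revK p) !coeff_pal -exprMn lerXn2r ?nnegrE ?coeff_ge0 ?mulr_ge0 ?hnorm_ge0//.
rewrite /coeff wapply_cat normc_adjoint//; last exact: wapply_dom.
by rewrite mulrC cauchy_schwarz.
Qed.

Lemma normc_sum (r : seq 'I_n) (f : 'I_n -> R[i]) :
  normc (\sum_(k <- r) f k) <= \sum_(k <- r) normc (f k).
Proof.
elim: r => [|a r IH]; first by rewrite !big_nil Normc.normc0.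
by rewrite !big_cons; apply: le_trans (le_normcD _ _) _; rewrite lerD2l.
Qed.

Lemma ip_sum (c : 'I_n -> R[i]) (e : 'I_n -> V) v :
  ip (\sum_k c k *: e k) v = \sum_k c k * ip (e k) v.
Proof.
elim/big_ind2: _ => [|x1 x2 y1 y2 <- <-|k _]; first exact: ip0l.
- exact: ipDl.
- exact: ipZl.
Qed.

(** The commutator is expanded in the span inside the word; [K] is the sum of the moduli of all its
    coefficients. *)
Lemma coeff_swap : commutators_in_span X D ->
  exists2 K : R, 0 <= K & forall p i j q,
    coeff (p ++ j :: i :: q) <= coeff (p ++ i :: j :: q) + K * \sum_(l < n) coeff (p ++ l :: q).
Proof.
move=> hc.
have [c hcP] := fin_all_exists (fun i => fin_all_exists (hc i)).
pose K := \sum_i \sum_j \sum_k normc (c i j k).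
have nge0 (z : R[i]) : 0 <= normc z by case: z => ? ?; exact: sqrtr_ge0.
exists K; first by do 3 apply: sumr_ge0 => ? _.
have cK i j k : normc (c i j k) <= K.
  rewrite /K (bigD1 i)//= (bigD1 j)//= (bigD1 k)//= -!addrA lerDl !addr_ge0//.
  - by apply: sumr_ge0.
  - by do 2 apply: sumr_ge0 => ? _.
  - by do 3 apply: sumr_ge0 => ? _.
move=> p i j q; rewrite /coeff !wapply_cat /=.
set v := wapply X q u; have Dv : D v by exact: wapply_dom.
have DX k w : D w -> D (X k w) by move=> Dw; have [] := hD k Dw.
have Dij : D (X i (X j v)) by apply: (DX); exact: DX.
have -> : X j (X i v) = X i (X j v) + \sum_k c j i k *: X k v.
  by rewrite -hcP// addrC subrK.
rewrite wapply_sum//; last by move=> k; exact: DX.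
rewrite ipDl// ip_sum; apply: le_trans (le_normcD _ _) _; rewrite lerD2l.
apply: le_trans (normc_sum _ _) _; rewrite mulr_sumr; apply: ler_sum => k _.
by rewrite Normc.normcM wapply_cat ler_wpM2r.
Qed.
End OperatorWords.

(** * From weights by length to weights by letter counts, and the equivalence *)

Lemma moderate_growth_sum (R : realType) (m : nat -> R) (H : R) (I : Type) (r : seq I)
    (f : I -> nat) : (forall p, 0 < m p) -> m 0%N = 1 -> 1 <= H ->
  (forall p q, m (p + q)%N <= H ^+ (p + q) * m p * m q) ->
  m (\sum_(i <- r) f i)%N
    <= (H ^+ size r) ^+ (\sum_(i <- r) f i)%N * \prod_(i <- r) m (f i).
Proof.
move=> m0 m1 H1 hH; have H0 : 0 <= H by lra.
elim: r => [|a r IH]; first by rewrite !big_nil m1 expr0 mulr1.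
rewrite !big_cons /=; set s := (\sum_(i <- r) f i)%N in IH *; set P := \prod_(i <- r) _ in IH *.
(* Each index costs one use of the inequality, hence the base [H ^+ size r]. *)
apply: (le_trans (hH _ _)); rewrite exprSr exprMn [leRHS]mulrAC -[leRHS]mulrA.
set E := H ^+ (f a + s); have E0 : 0 <= E by exact: exprn_ge0.
have -> : (H ^+ size r) ^+ (f a + s) * (m (f a) * P * E)
   = E * m (f a) * ((H ^+ size r) ^+ (f a + s) * P) by ring.
apply: ler_wpM2l; first by rewrite mulr_ge0 ?(ltW (m0 _)).
apply: (le_trans IH); apply: ler_wpM2r; first by apply: prodr_ge0 => ? _; exact: ltW.
by rewrite ler_weXn2l ?leq_addl// exprn_ege1.
Qed.

Lemma mword_nseq (R : realType) (n : nat) (m : nat -> R) k (j : 'I_n) :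
  m 0%N = 1 -> mword m (nseq k j) = m k.
Proof.
move=> m0; rewrite /mword (bigD1 j)//= big1 ?mulr1 => [|l lj].
  by rewrite count_nseq /= eqxx mul1n.
by rewrite count_nseq /= eq_sym (negbTE lj).
Qed.

Theorem theorem3p1 (R : realType) (V : lmodType R[i]) (ip : V -> V -> R[i])
    (n : nat) (dom : 'I_n -> V -> Prop) (X : 'I_n -> V -> V) (D : V -> Prop)
    (m : nat -> R) :
  is_hilbert ip ->
  (forall j, is_operator (dom j) (X j)) ->
  (forall j, is_hermitian ip (dom j) (X j) \/ is_skew_hermitian ip (dom j) (X j)) ->
  common_invariant_domain dom X D ->
  (forall p, 0 < m p) ->
  cond_A0 m -> cond_A1 m -> cond_A2 m -> cond_A3' m ->
  commutators_in_span X D ->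
  forall u, D u ->
    (S_multi ip dom X m u <-> forall j, S_single ip (dom j) (X j) m u).
Proof.
move=> [hip _] hop hsym hD m0 [m0' m1] _ [H [H0 hH]] [L [L1 hL]] hcom u Du; split.
  move=> [_ [A [C [A0 [C0 h]]]]] j; split; first exact: (Cinf1_dom hD).
  exists A, C; do 2 split=> //; move=> k k0.
  (* The bounds for one operator are those for the words [j^k]. *)
  by have := h (nseq k j); rewrite size_nseq wapply_nseq mword_nseq//; apply.
move=> hS; split; first by move=> w _; exact: (wdom_all hD).
have h1 j : exists AC : R * R, [/\ 0 < AC.1, 0 < AC.2 & forall k, (1 <= k)%N ->
    hnorm ip (iter k (X j) u) <= AC.2 * AC.1 ^+ k * m k].
  by have [_ [A [C [A0 [C0 h]]]]] := hS j; exists (A, C).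
have [AC hAC] := fin_all_exists h1.
(* Constants common to all letters; the 1 keeps them positive even for [n = 0]. *)
pose A := 1 + \sum_j (AC j).1; pose C := 1 + \sum_j (AC j).2.
have AC0 j : 0 < (AC j).1 /\ 0 < (AC j).2 by have [] := hAC j.
have A0 : 0 < A by rewrite ltr_pwDl// sumr_ge0// => j _; exact: ltW (AC0 j).1.
have C0 : 0 < C by rewrite ltr_pwDl// sumr_ge0// => j _; exact: ltW (AC0 j).2.
have leA j : (AC j).1 <= A.
  by rewrite /A (bigD1 j)//= addrCA lerDl addr_ge0// sumr_ge0// => l _; exact: ltW (AC0 l).1.
have leC j : (AC j).2 <= C.
  by rewrite /C (bigD1 j)//= addrCA lerDl addr_ge0// sumr_ge0// => l _; exact: ltW (AC0 l).2.
have [K K0 hK] := coeff_swap hip hop hD Du hcom.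
have hF i k : (0 < k)%N -> coeff ip X u (nseq k.*2 i) <= (C * A ^+ k * m k) ^+ 2.
  move=> k0; rewrite -addnn nseqD -{1}rev_nseq (coeff_pal hip hsym hD Du) wapply_nseq.
  have [_ _ h] := hAC i; have [a0 c0] := AC0 i.
  rewrite lerXn2r ?nnegrE ?hnorm_ge0//.
    by rewrite !mulr_ge0 ?exprn_ge0 ?(ltW (m0 _)) ?(ltW A0) ?(ltW C0).
  apply: (le_trans (h k k0)); apply: ler_wpM2r; first exact: ltW.
  apply: ler_pM => //; [exact: ltW|exact: exprn_ge0 (ltW a0)|].
  by apply: lerXn2r; rewrite ?nnegrE ?(ltW a0) ?(ltW A0).
have L0 : 0 <= L by lra.
have [A' [C' [A'0 C'0 hw]]] := word_growth (@coeff_ge0 _ _ ip _ X u) K0 hK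
  (coeff_cauchy hip hsym hD Du) m0 m1 hL L0 A0 C0 hF.
(* [H] may be below 1; the enlarged constant has nondecreasing powers. *)
pose H' := H + 1; have H'1 : 1 <= H' by rewrite /H'; lra.
have hH' p q : m (p + q)%N <= H' ^+ (p + q) * m p * m q.
  apply: (le_trans (hH p q)); do 2 (apply: ler_wpM2r; first exact: ltW).
  by apply: lerXn2r; rewrite ?nnegrE /H'; lra.
exists (A' * H' ^+ n), C'; split; first by rewrite mulr_gt0 ?exprn_gt0//; lra.
split=> // w w0.
have := hw w w0; rewrite (coeff_pal hip hsym hD Du) ler_pXn2r ?nnegrE ?hnorm_ge0//; last first.
  by rewrite !mulr_ge0 ?exprn_ge0 ?(ltW (m0 _)) ?(ltW A'0) ?(ltW C'0).
move=> h; apply: (le_trans h).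
(* Splitting [m (size w)] over the [n] letters costs [H' ^+ n] per position, which is put into the
   new rate. *)
have := moderate_growth_sum (index_enum 'I_n) (fun j => count_mem j w) m0 m0' H'1 hH'.
rewrite sum_count_mem -[size (index_enum _)]sum1_size sum_nat_const card_ord muln1 => h2.
rewrite exprMn mulrA -[leRHS]mulrA; apply: ler_wpM2l => //.
by rewrite mulr_ge0 ?exprn_ge0 ?ltW.
Qed.
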